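(* Let $G(\lambda)\in\mathbb F(\lambda)^{p\times m}$ and let $P(\lambda)=\begin{bmatrix} A(\lambda) & B(\lambda)\\ -C(\lambda) & D(\lambda)\end{bmatrix}$ be a polynomial system matrix of $G(\lambda)$. (a) If $A(\lambda)$ and $C(\lambda)$ are right coprime, $A(\lambda)^{-1}B(\lambda)$ is proper, $H_2(\lambda)$ is a right minimal basis of $G(\lambda)$ and $H_1(\lambda)=-A(\lambda)^{-1}B(\lambda)H_2(\lambda)$, then $\begin{bmatrix}H_1(\lambda)\\H_2(\lambda)\end{bmatrix}$ is a right minimal basis of $P(\lambda)$. Moreover, the right minimal indices of $P(\lambda)$ and $G(\lambda)$ are the same. (b) If $A(\lambda)$ and $B(\lambda)$ are left coprime, $C(\lambda)A(\lambda)^{-1}$ is proper, $H_2(\lambda)$ is a left minimal basis of $G(\lambda)$ and $H_1(\lambda)=(C(\lambda)A(\lambda)^{-1})^TH_2(\lambda)$, then $\begin{bmatrix}H_1(\lambda)\\H_2(\lambda)\end{bmatrix}$ is a left minimal basis of $P(\lambda)$. Moreover, the left minimal indices of $P(\lambda)$ and $G(\lambda)$ are the same.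
   Context: $\mathbb F$ is an arbitrary field, $\overline{\mathbb F}$ its algebraic closure. A polynomial system matrix of $G(\lambda)\in\mathbb F(\lambda)^{p\times m}$ is $P(\lambda)=\begin{bmatrix} A(\lambda) & B(\lambda)\\ -C(\lambda) & D(\lambda)\end{bmatrix}$ with $A\in\mathbb F[\lambda]^{n\times n}$ regular, $B\in\mathbb F[\lambda]^{n\times m}$, $C\in\mathbb F[\lambda]^{p\times n}$, $D\in\mathbb F[\lambda]^{p\times m}$, and $G=D+CA^{-1}B$. $A,C$ are right coprime if all common right divisors are unimodular (equivalently $\begin{bmatrix}A(\lambda_0)\\ C(\lambda_0)\end{bmatrix}$ has full column rank for all $\lambda_0\in\overline{\mathbb F}$); $A,B$ are left coprime if $A^T,B^T$ are right coprime. A rational matrix is proper if each entry has numerator degree at most denominator degree. For a subspace of $\mathbb F(\lambda)^k$, a minimal basis is a polynomial basis minimizing the sum of the degrees of its vectors, and the minimal indices are the degrees of its vectors. A polynomial matrix is a right (left) minimal basis of a rational matrix $G$ if its columns form a minimal basis of $\mathcal N_r(G)=\{x:Gx=0\}$ ($\mathcal N_\ell(G)=\{x:x^TG=0\}$); the right (left) minimal indices of $G$ are those of $\mathcal N_r(G)$ ($\mathcal N_\ell(G)$). *)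

(* Defs.v *)
From HB Require Import structures.
From mathcomp Require Import all_boot all_order all_algebra.
Set Implicit Arguments. Unset Strict Implicit. Unset Printing Implicit Defensive.
Import Order.TTheory GRing.Theory Num.Theory.
Local Open Scope ring_scope.

Section Defs.
Variable F : fieldType.

Definition ratF := {fraction {poly F}}.

Definition ptor (q : {poly F}) : ratF := FracField.tofrac q.

Definition pmx (a b : nat) (M : 'M[{poly F}]_(a, b)) : 'M[ratF]_(a, b) :=
  map_mx ptor M.

Definition regular_pmx n (A : 'M[{poly F}]_n) : Prop := \det A != 0.

Definition unimodular n (W : 'M[{poly F}]_n) : Prop := W \in unitmx.

Definition right_coprime n p (A : 'M[{poly F}]_n) (C : 'M[{poly F}]_(p, n)) : Prop :=
  forall (W : 'M[{poly F}]_n) (A1 : 'M[{poly F}]_n) (C1 : 'M[{poly F}]_(p, n)),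
    A = A1 *m W -> C = C1 *m W -> unimodular W.

Definition left_coprime n m (A : 'M[{poly F}]_n) (B : 'M[{poly F}]_(n, m)) : Prop :=
  right_coprime A^T B^T.

(* A rational function is proper: numerator degree <= denominator degree
   (size = degree + 1; independent of the chosen representation). *)
Definition proper_rat (x : ratF) : Prop :=
  exists nu de : {poly F}, de != 0 /\ x = ptor nu / ptor de /\ (size nu <= size de)%N.

Definition proper_mx a b (M : 'M[ratF]_(a, b)) : Prop :=
  forall i j, proper_rat (M i j).

Definition coldeg k r (H : 'M[{poly F}]_(k, r)) (j : 'I_r) : nat :=
  (\max_(i < k) size (H i j)).-1.

Definition coldegs k r (H : 'M[{poly F}]_(k, r)) : seq nat :=
  [seq coldeg H j | j <- enum 'I_r].

Definition degsum k r (H : 'M[{poly F}]_(k, r)) : nat :=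
  (\sum_(j < r) coldeg H j)%N.

Definition poly_basis k (V : 'cV[ratF]_k -> Prop) r (H : 'M[{poly F}]_(k, r)) : Prop :=
  \rank (pmx H) = r /\
  (forall x : 'cV[ratF]_k, V x <-> exists y : 'cV[ratF]_r, x = pmx H *m y).

Definition minimal_basis k (V : 'cV[ratF]_k -> Prop) r (H : 'M[{poly F}]_(k, r)) : Prop :=
  poly_basis V H /\
  forall r' (H' : 'M[{poly F}]_(k, r')), poly_basis V H' -> (degsum H <= degsum H')%N.

Definition right_minimal_basis a b (G : 'M[ratF]_(a, b)) r (H : 'M[{poly F}]_(b, r)) :=
  minimal_basis (fun x : 'cV[ratF]_b => G *m x = 0) H.

Definition left_minimal_basis a b (G : 'M[ratF]_(a, b)) r (H : 'M[{poly F}]_(a, r)) :=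
  minimal_basis (fun x : 'cV[ratF]_a => x^T *m G = 0) H.

(* Minimal indices of G and G' coincide: the degree multisets of any
   minimal bases agree (they are well defined). *)
Definition same_right_min_indices a b a' b' (G : 'M[ratF]_(a, b)) (G' : 'M[ratF]_(a', b')) :=
  forall r (H : 'M[{poly F}]_(b, r)) r' (H' : 'M[{poly F}]_(b', r')),
    right_minimal_basis G H -> right_minimal_basis G' H' -> perm_eq (coldegs H) (coldegs H').

Definition same_left_min_indices a b a' b' (G : 'M[ratF]_(a, b)) (G' : 'M[ratF]_(a', b')) :=
  forall r (H : 'M[{poly F}]_(a, r)) r' (H' : 'M[{poly F}]_(a', r')),
    left_minimal_basis G H -> left_minimal_basis G' H' -> perm_eq (coldegs H) (coldegs H').

Definition sysmx n m p (A : 'M[{poly F}]_n) (B : 'M[{poly F}]_(n, m))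
  (C : 'M[{poly F}]_(p, n)) (D : 'M[{poly F}]_(p, m)) : 'M[{poly F}]_(n + p, n + m) :=
  block_mx A B (- C) D.

End Defs.

(* Main.v *)
(* The map x |-> (-A^-1 B x, x) identifies the kernel of G with that of P.
   Properness of A^-1 B makes it preserve the degrees of polynomial vectors, and
   right coprimeness of A and C makes it preserve polynomiality, since
   A x1 = - B x2 and C x1 = D x2 are polynomial. So it puts the minimal bases of G
   in a degree-preserving bijection with those of P. Minimal indices are well
   defined by the exchange property of bases. Part (b) is part (a) for the
   transposed system matrix [A^T, -C^T; B^T, D^T]. *)
Require Import Defs.
From HB Require Import structures.
From Corelib Require Import Setoid.
From mathcomp Require Import all_boot all_order all_algebra.
Import GRing.Theory.
Local Open Scope ring_scope.

Section MinimalBases.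
Set Implicit Arguments.
Unset Strict Implicit.
Unset Printing Implicit Defensive.
Variable F : fieldType.
Notation K := (ratF F).

(** * Polynomial matrices as rational matrices, and column rank *)

HB.instance Definition _ := GRing.RMorphism.copy (@ptor F) (@FracField.tofrac {poly F}).

Lemma ptor_inj : injective (@ptor F).
Proof. by move=> x y /eqP; rewrite /ptor tofrac_eq => /eqP. Qed.

Lemma pmx_inj a b : injective (@pmx F a b).
Proof.
move=> M N /matrixP eqMN; apply/matrixP => i j.
by apply: ptor_inj; have := eqMN i j; rewrite !mxE.
Qed.

Lemma pmxM a b c (M : 'M[{poly F}]_(a, b)) (N : 'M_(b, c)) :
  pmx (M *m N) = pmx M *m pmx N.
Proof. exact: map_mxM. Qed.

Lemma pmxN a b (M : 'M[{poly F}]_(a, b)) : pmx (- M) = - pmx M.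
Proof. exact: map_mxN. Qed.

Lemma pmx_tr a b (M : 'M[{poly F}]_(a, b)) : pmx M^T = (pmx M)^T.
Proof. by rewrite /pmx map_trmx. Qed.

Lemma pmx_unit n (A : 'M[{poly F}]_n) : regular_pmx A -> pmx A \in unitmx.
Proof. by move=> Areg; rewrite unitmxE det_map_mx unitfE tofrac_eq0. Qed.

Lemma rank_colP (R : fieldType) a b (M : 'M[R]_(a, b)) :
  \rank M = b <-> forall y : 'cV_b, M *m y = 0 -> y = 0.
Proof.
split=> [rkM y My0 | injM].
  have freeM : row_free M^T by rewrite /row_free mxrank_tr rkM.
  apply: trmx_inj; apply: (row_free_inj freeM).
  by rewrite -trmx_mul My0 !trmx0 mul0mx.
rewrite -mxrank_tr; apply/eqP/inj_row_free => v vM0.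
apply: trmx_inj; rewrite trmx0; apply: injM.
by apply: trmx_inj; rewrite trmx_mul trmxK vM0 trmx0.
Qed.

Lemma unitmx_colP (R : fieldType) n (M : 'M[R]_n) :
  (forall y : 'cV_n, M *m y = 0 -> y = 0) -> M \in unitmx.
Proof. by move/rank_colP => rkM; rewrite -row_full_unit /row_full rkM. Qed.

(** * Right coprimeness and polynomial solutions *)

(* If [A g = d a] and [C g = d c] with [g i = 1], then the identity matrix with
   column [i] replaced by [(-g_1, .., d, .., -g_n)] divides both [A] and [C]
   on the right: [a] and [c] are the [i]-th columns of the two quotients. *)
Lemma right_coprime_unit n p (A : 'M[{poly F}]_n) (C : 'M_(p, n))
    (d : {poly F}) (g a : 'cV_n) (c : 'cV_p) i :
  right_coprime A C -> A *m g = d *: a -> C *m g = d *: c -> g i 0 = 1 ->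
  size d = 1%N.
Proof.
move=> AC Ag Cg gi.
pose W : 'M[{poly F}]_n :=
  \matrix_(k, j) if j == i then (if k == i then d else - g k 0) else (k == j)%:R.
pose Q q (M : 'M[{poly F}]_(q, n)) (v : 'cV_q) : 'M_(q, n) :=
  \matrix_(k, j) if j == i then v k 0 else M k j.
have QW q (M : 'M_(q, n)) v : M *m g = d *: v -> M = Q q M v *m W.
  move=> /matrixP/(_ _ 0) Mg; apply/matrixP => k j; rewrite !mxE.
  have [->|ji] := eqVneq j i.
    rewrite (bigD1 i) //= !mxE !eqxx.
    have := Mg k; rewrite !mxE (bigD1 i) //= gi mulr1 [d * _]mulrC => <-.
    rewrite -addrA -big_split big1 ?addr0 // => l li.
    by rewrite !mxE !eqxx !(negPf li) mulrN; exact: subrr.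
  rewrite (bigD1 j) //= !mxE eqxx (negPf ji) mulr1 big1 ?addr0 // => l lj.
  by rewrite !mxE (negPf ji) (negPf lj) mulr0.
have uW : W \in unitmx by exact: AC (QW _ _ _ Ag) (QW _ _ _ Cg).
(* Row [i] of [W] is [d] times a unit vector, so the diagonal entry [i] of [W *m invmx W = 1]
   exhibits [d] as a divisor of 1. *)
have := mulmxV uW => /matrixP/(_ i i); rewrite !mxE eqxx (bigD1 i) //= big1.
  rewrite addr0 !mxE !eqxx => dV.
  have : d %| 1 by rewrite -[1](dV : d * invmx W i i = 1) dvdp_mulr.
  by rewrite dvdp1 => /eqP.
by move=> l li; rewrite !mxE (negPf li) eq_sym (negPf li) mul0r.
Qed.

(** Induction on the degree of [d]. Suppose [d] does not divide [g i 0], and let [e] be their gcd.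
    If [e] is constant, Bezout coefficients turn entry [i] of [g] into 1, and [right_coprime_unit]
    makes [d] constant. Otherwise [e] and [d %/ e] both have smaller degree than [d]: first [e]
    divides all of [g], then [d %/ e] divides the quotient. *)
Lemma right_coprime_dvd n p (A : 'M[{poly F}]_n) (C : 'M_(p, n))
    (d : {poly F}) (g a : 'cV_n) (c : 'cV_p) :
  right_coprime A C -> d != 0 -> A *m g = d *: a -> C *m g = d *: c ->
  forall i, d %| g i 0.
Proof.
move=> AC; have [s] := ubnP (size d).
elim: s d g a c => // s IHs d g a c les d0 Ag Cg i.
apply: contraT => Ndg; set e := gcdp d (g i 0).
have ed : e %| d by exact: dvdp_gcdl.
have e0 : e != 0 by rewrite gcdp_eq0 negb_and d0.
have lted : (size e < size d)%N.
  rewrite ltn_neqAle dvdp_leq // andbT (dvdp_size_eqp ed).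
  by apply: contra Ndg => /eqp_dvdl <-; exact: dvdp_gcdr.
have dE : d = d %/ e * e by rewrite divpK.
have [e1|e1] := eqVneq (size e) 1%N.
  have : coprimep d (g i 0) by rewrite /coprimep -/e e1.
  move=> /Bezout_eq1_coprimepP[[u v] /= uv].
  (* Adding a multiple of [d] times a unit vector keeps the image under [M] divisible by [d]. *)
  have Bez q (M : 'M_(q, n)) w : M *m g = d *: w ->
      M *m (v *: g + (u * d) *: delta_mx i 0) = d *: (v *: w + u *: col i M).
    move=> Mg; rewrite mulmxDr -!scalemxAr Mg colE scalerDr !scalerA.
    by rewrite (mulrC v) (mulrC u).
  have := right_coprime_unit AC (Bez _ _ _ Ag) (Bez _ _ _ Cg) (i := i).
  rewrite !mxE !eqxx mulr1 addrC uv => /(_ erefl) d1.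
  by case/negP: Ndg; move/eqP: d1; rewrite -dvdp1 => /dvdp_trans -> //; exact: dvd1p.
have IHe : forall k, e %| g k 0.
  apply: (IHs e g ((d %/ e) *: a) ((d %/ e) *: c)) => //.
  - exact: leq_trans lted _.
  - by rewrite scalerA mulrC -dE.
  - by rewrite scalerA mulrC -dE.
pose g' : 'cV[{poly F}]_n := \col_k (g k 0 %/ e).
have gE : g = e *: g'.
  by apply/matrixP => k j; rewrite !mxE ord1 mulrC divpK.
have q0 : d %/ e != 0 by apply: contraNneq d0 => q0; rewrite dE q0 mul0r.
have cancel q (M : 'M_(q, n)) w : M *m g = d *: w -> M *m g' = (d %/ e) *: w.
  rewrite gE -scalemxAr {1}dE (mulrC _ e) -scalerA => /matrixP eqe.
  apply/matrixP => k j; apply: (mulfI e0).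
  by have := eqe k j; rewrite mxE [RHS]mxE.
have sq : (size (d %/ e)%R < s)%N.
  apply: leq_trans (_ : size d <= s)%N => //.
  rewrite size_divp // ltn_subrL [X in _ && X]size_poly_gt0 d0 andbT.
  by rewrite -subn1 subn_gt0 ltn_neqAle eq_sym e1 size_poly_gt0.
have := IHs _ _ _ _ sq q0 (cancel _ _ _ Ag) (cancel _ _ _ Cg) i => q_dvd.
by case/negP: Ndg; rewrite dE gE mxE [e * _]mulrC dvdp_mul.
Qed.

(** As [A x] is polynomial, [\det A] is a common denominator of [x]; [right_coprime_dvd], applied to
    each column of [\adj A *m a], cancels it. *)
Lemma right_coprime_poly n p r (A : 'M[{poly F}]_n) (C : 'M_(p, n))
    (x : 'M[K]_(n, r)) (a : 'M[{poly F}]_(n, r)) (c : 'M_(p, r)) :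
  regular_pmx A -> right_coprime A C ->
  pmx A *m x = pmx a -> pmx C *m x = pmx c -> exists h, x = pmx h.
Proof.
move=> d0 AC Ax Cx; set d := \det A in d0.
have dx : ptor d *: x = pmx (\adj A *m a).
  by rewrite pmxM -Ax mulmxA -pmxM mul_adj_mx /pmx map_scalar_mx mul_scalar_mx.
have scale q (M : 'M_(q, n)) (w : 'M_(q, r)) : pmx M *m x = pmx w ->
    M *m (\adj A *m a) = d *: w.
  move=> Mx; apply: pmx_inj.
  by rewrite pmxM -dx -scalemxAr Mx; apply/matrixP => i j; rewrite !mxE -rmorphM.
move: (\adj A *m a) dx scale => y dx scale.
have dvd i j : d %| y i j.
  have colE q (M : 'M_(q, n)) (w : 'M_(q, r)) : pmx M *m x = pmx w ->
      M *m col j y = d *: col j w.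
    by move/scale => Mw; rewrite !colE mulmxA Mw scalemxAl.
  have := right_coprime_dvd AC d0 (colE _ _ _ Ax) (colE _ _ _ Cx) i.
  by rewrite [col _ _ _ _]mxE.
exists (\matrix_(i, j) (y i j %/ d)).
apply/matrixP => i j; apply: (@mulfI _ (ptor d)); first by rewrite tofrac_eq0.
have := dx => /matrixP/(_ i j); rewrite mxE => ->.
by rewrite !mxE -rmorphM mulrC divpK.
Qed.

(** * Degrees of rational functions and properness *)

(* "[x] has degree less than [t]": the degree of [nu / de] is at most [t - 1],
   so that [t] plays the part of [size] for a rational function. *)
Definition size_lt (x : K) (t : nat) : Prop :=
  exists nu de : {poly F},
    [/\ de != 0, x = ptor nu / ptor de & (size nu < size de + t)%N].

Lemma size_ratD t x y : size_lt x t -> size_lt y t -> size_lt (x + y) t.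
Proof.
move=> [nu [de [de0 -> nu_de]]] [nu' [de' [de0' -> nu_de']]].
have lt_mul (a b c : {poly F}) : c != 0 -> (size a < size b + t)%N ->
    (size (a * c)%R < (size b + size c).-1 + t)%N.
  rewrite -size_poly_gt0 => c0 ab; have := size_polyMleq a c.
  case: (size c) c0 => // k _; rewrite !addnS /= => /leq_ltn_trans; apply.
  by rewrite addnAC ltn_add2r.
exists (nu * de' + nu' * de), (de * de'); split; first exact: mulf_neq0.
  by rewrite rmorphD !rmorphM addf_div ?tofrac_eq0.
apply: leq_ltn_trans (size_polyD _ _) _.
rewrite [size (de * de')]size_mul // gtn_max lt_mul //=.
by rewrite (addnC (size de)) lt_mul.
Qed.

Lemma size_rat_poly (h : {poly F}) t : size_lt (ptor h) t -> (size h <= t)%N.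
Proof.
move=> [nu [de [de0 hE]]].
have -> : nu = h * de.
  by apply: ptor_inj; rewrite rmorphM /= hE divfK // tofrac_eq0.
have [-> | h0] := eqVneq h 0; first by rewrite size_poly0.
rewrite size_mul // addnC.
move: h0; rewrite -size_poly_gt0; case: (size h) => // k _.
by rewrite addnS /= ltn_add2l.
Qed.

Lemma proper_mul_size x (h : {poly F}) t :
  proper_rat x -> (size h <= t)%N -> size_lt (x * ptor h) t.
Proof.
move=> [nu [de [de0 [-> nu_de]]]] ht; exists (nu * h), de; split=> //.
  by rewrite rmorphM mulrAC.
have de_gt0 : (0 < size de)%N by rewrite size_poly_gt0.
apply: leq_ltn_trans (size_polyMleq _ _) _.
(* When both sizes are 0 the predecessor in the bound for the product truncates; [size de > 0] then
   still gives the strict inequality. *)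
case: (posnP (size nu + size h)) => [-> | sum_gt0].
  by rewrite ltn_addr.
by rewrite prednK // leq_add.
Qed.

Lemma proper_mxN n m (M : 'M[K]_(n, m)) : proper_mx (- M) -> proper_mx M.
Proof.
move=> Mproper i j; have [nu [de [de0 [E nu_de]]]] := Mproper i j.
exists (- nu), de; rewrite size_polyN rmorphN mulNr -E mxE opprK.
by split.
Qed.

(** Each entry of column [j] of [H1] is a sum of proper functions times entries of column [j] of
    [H2], so the upper block cannot raise the maximal degree. *)
Lemma proper_coldeg n m r (M : 'M[K]_(n, m)) (H1 : 'M[{poly F}]_(n, r))
    (H2 : 'M_(m, r)) j :
  proper_mx M -> pmx H1 = M *m pmx H2 -> coldeg (col_mx H1 H2) j = coldeg H2 j.
Proof.
move=> Mproper H1E; rewrite /coldeg big_split_ord /=; congr _.-1.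
under eq_bigr do rewrite col_mxEu.
under [X in maxn _ X]eq_bigr do rewrite col_mxEd.
apply/maxn_idPr/bigmax_leqP => i _; apply: size_rat_poly.
have -> : ptor (H1 i j) = \sum_k M i k * ptor (H2 k j).
  have := H1E => /matrixP/(_ i j); rewrite !mxE => ->; apply: eq_bigr => k _.
  by congr (_ * _); rewrite mxE.
apply: (big_ind (size_lt^~ _)) => [||k _].
(* The size 1 of the denominator keeps the bound strict even if column [j] of [H2] is zero. *)
- by exists 0, 1; rewrite oner_neq0 rmorph0 mul0r size_poly0 size_poly1.
- exact: size_ratD.
- by apply: proper_mul_size => //; exact: (leq_bigmax k).
Qed.

(** * Change of basis, exchange, and uniqueness of minimal indices *)

Lemma poly_basis_unit k (V : 'cV[K]_k -> Prop) r (H H' : 'M[{poly F}]_(k, r)) E :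
  poly_basis V H -> E \in unitmx -> pmx H' = pmx H *m E -> poly_basis V H'.
Proof.
move=> [rkH VH] uE H'E; split.
  by rewrite H'E mxrankMfree // row_free_unit.
move=> x; rewrite VH H'E; split=> -[y ->].
  by exists (invmx E *m y); rewrite -mulmxA mulKVmx.
by exists (E *m y); rewrite mulmxA.
Qed.

Lemma poly_basis_mulP k (V : 'cV[K]_k -> Prop) r (H : 'M[{poly F}]_(k, r))
    r' (H' : 'M[{poly F}]_(k, r')) :
  poly_basis V H -> poly_basis V H' -> exists Y, pmx H' = pmx H *m Y.
Proof.
move=> [_ VH] [_ VH'].
have sub : ((pmx H')^T <= (pmx H)^T)%MS.
  apply/row_subP => j; have /VH[y Hy] : V (col j (pmx H')).
    by apply/VH'; exists (delta_mx j 0); rewrite colE.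
  by rewrite -tr_col Hy trmx_mul submxMl.
have /submxP[Y H'E] := sub.
by exists Y^T; apply: trmx_inj; rewrite trmx_mul trmxK.
Qed.

(* Exchange: otherwise some [H'_j] of degree less than [t] has a nonzero
   coordinate along some [H_i] of degree at least [t], and putting [H'_j] in the
   place of [H_i] lowers the sum of the degrees. *)
Lemma minimal_basis_card_leq k (V : 'cV[K]_k -> Prop) r (H : 'M[{poly F}]_(k, r))
    r' (H' : 'M_(k, r')) t :
  minimal_basis V H -> poly_basis V H' ->
  (#|[set j | coldeg H' j < t]| <= #|[set i | coldeg H i < t]|)%N.
Proof.
move=> [bH minH] bH'.
have [Y H'E] := poly_basis_mulP bH bH'.
set J := [set j | _]; set I := [set i | _].
have injY (y : 'cV_r') : Y *m y = 0 -> y = 0.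
  move=> Yy0; case: bH' => /rank_colP injH' _; apply: injH'.
  by rewrite H'E -mulmxA Yy0 mulmx0.
(* If the vectors of [H'] indexed by [J] involve only vectors of [H] indexed by [I], the [I] by [J]
   block of [Y] has independent columns, so it has at least as many rows as columns. *)
case: (boolP [forall j in J, forall i, (i \notin I) ==> (Y i j == 0)]).
  move=> /forall_inP YIJ.
  pose Z := \matrix_(i < #|I|, j < #|J|) Y (enum_val i) (enum_val j).
  suff <- : \rank Z = #|J| by exact: rank_leq_row.
  apply/rank_colP => z Zz0.
  (* [S] pads a vector indexed by [J] with zeros, so that injectivity of [Y] applies. *)
  pose S : 'M[K]_(r', #|J|) := \matrix_(l, j) (l == enum_val j)%:R.
  have YS i j : (Y *m S) i j = Y i (enum_val j).
    rewrite mxE (bigD1 (enum_val j)) //= mxE eqxx mulr1 big1 ?addr0 // => l lj.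
    by rewrite mxE (negPf lj) mulr0.
  have /injY Sz0 : Y *m (S *m z) = 0.
    apply/matrixP => i o; rewrite mulmxA [RHS]mxE [LHS]mxE.
    have [Ii|NIi] := boolP (i \in I).
      have := Zz0 => /matrixP/(_ (enum_rank_in Ii i) o); rewrite !mxE => Zi0.
      rewrite -[RHS]Zi0.
      by apply: eq_bigr => j _; rewrite YS [Z _ _]mxE enum_rankK_in.
    apply: big1 => j _; rewrite YS.
    have /forallP/(_ i) := YIJ _ (enum_valP j).
    by rewrite NIi /= => /eqP ->; rewrite mul0r.
  apply/matrixP => j o; have := Sz0 => /matrixP/(_ (enum_val j) o).
  rewrite !mxE (bigD1 j) //= mxE eqxx mul1r big1 ?addr0 // => l lj.
  by rewrite mxE (inj_eq enum_val_inj) eq_sym (negPf lj) mul0r.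
rewrite negb_forall => /existsP[j]; rewrite negb_imply => /andP[Jj].
rewrite negb_forall => /existsP[i]; rewrite negb_imply => /andP[NIi Yij].
pose H'' : 'M[{poly F}]_(k, r) := \matrix_(a, b) if b == i then H' a j else H a b.
(* The matrix of the exchange: the identity with column [i] replaced by column [j] of [Y],
   invertible because [Y i j] is nonzero. *)
pose E : 'M[K]_r := \matrix_(a, b) if b == i then Y a j else (a == b)%:R.
have H''E : pmx H'' = pmx H *m E.
  apply/matrixP => a b; rewrite !mxE; have [->|bi] := eqVneq b i.
    have := H'E => /matrixP/(_ a j); rewrite !mxE => ->.
    by apply: eq_bigr => l _; rewrite !mxE eqxx.
  rewrite (bigD1 b) //= !mxE (negPf bi) eqxx mulr1 big1 ?addr0 // => l lb.
  by rewrite !mxE (negPf bi) (negPf lb) mulr0.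
have uE : E \in unitmx.
  apply: unitmx_colP => y Ey0.
  have yi : y i 0 = 0.
    have := Ey0 => /matrixP/(_ i 0); rewrite !mxE (bigD1 i) //= mxE eqxx big1.
      by rewrite addr0 => /eqP; rewrite mulf_eq0 (negPf Yij) => /eqP.
    by move=> l li; rewrite mxE (negPf li) eq_sym (negPf li) mul0r.
  apply/matrixP => a o; rewrite ord1 [RHS]mxE; have [->//|ai] := eqVneq a i.
  have := Ey0 => /matrixP/(_ a 0); rewrite !mxE (bigD1 a) //=.
  rewrite mxE (negPf ai) eqxx mul1r big1 ?addr0 // => l la.
  have [->|li] := eqVneq l i; first by rewrite yi mulr0.
  by rewrite mxE (negPf li) eq_sym (negPf la) mul0r.
have := minH _ _ (poly_basis_unit bH uE H''E); rewrite leqNgt => /negP[].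
rewrite /degsum (bigD1 i) //= [X in (_ < X)%N](bigD1 i) //=.
have -> : coldeg H'' i = coldeg H' j.
  by rewrite /coldeg; congr _.-1; apply: eq_bigr => a _; rewrite mxE eqxx.
have -> : (\sum_(l < r | l != i) coldeg H'' l = \sum_(l < r | l != i) coldeg H l)%N.
  apply: eq_bigr => l li; rewrite /coldeg; congr _.-1.
  by apply: eq_bigr => a _; rewrite mxE (negPf li).
rewrite ltn_add2r; move: Jj NIi; rewrite !inE -leqNgt; exact: leq_trans.
Qed.

(** The exchange bound, used in both directions, equates the numbers of degrees below every
    threshold; differences at consecutive thresholds are the multiplicities. *)
Lemma minimal_basis_coldegs k (V : 'cV[K]_k -> Prop) r (H : 'M[{poly F}]_(k, r))
    r' (H' : 'M_(k, r')) :
  minimal_basis V H -> minimal_basis V H' -> perm_eq (coldegs H) (coldegs H').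
Proof.
move=> minH minH'.
have countE s (M : 'M[{poly F}]_(k, s)) t :
    count (fun d => d < t)%N (coldegs M) = #|[set j | coldeg M j < t]%N|.
  rewrite /coldegs count_map -size_filter cardE /enum_mem -enumT filter_predT.
  by congr size; apply: eq_filter => j; rewrite !inE.
have lt_countE t :
    count (fun d => d < t)%N (coldegs H) = count (fun d => d < t)%N (coldegs H').
  rewrite !countE; apply/eqP; rewrite eqn_leq (minimal_basis_card_leq t minH' minH.1).
  by rewrite (minimal_basis_card_leq t minH minH'.1).
have countS t (s : seq nat) :
    (count (fun d => d < t.+1)%N s = count (fun d => d < t)%N s + count_mem t s)%N.
  rewrite -count_predUI [X in (_ = _ + X)%N](@eq_count _ _ pred0).
    by rewrite count_pred0 addn0; apply: eq_count => d /=; rewrite ltnS leq_eqVlt orbC.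
  by move=> d /=; case: ltngtP.
apply/allP => t _ /=; apply/eqP; apply: (@addnI (count (fun d => d < t)%N (coldegs H))).
by rewrite -countS [in RHS]lt_countE -countS lt_countE.
Qed.

(** * Kernels, transposition, and the system matrix *)

Lemma kernel_basis a b (P : 'M[K]_(a, b)) r (H : 'M[{poly F}]_(b, r)) :
  poly_basis (fun x => P *m x = 0) H -> P *m pmx H = 0.
Proof.
move=> [_ PH]; apply: trmx_inj; apply/row_matrixP => j.
rewrite trmx0 row0 -tr_col colE -mulmxA; apply: trmx_inj; rewrite trmxK trmx0.
by apply/PH; exists (delta_mx j 0).
Qed.

Lemma left_minimal_basis_tr a b (P : 'M[K]_(a, b)) r (H : 'M[{poly F}]_(a, r)) :
  left_minimal_basis P H <-> right_minimal_basis P^T H.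
Proof.
have trP (x : 'cV_a) : x^T *m P = 0 <-> P^T *m x = 0.
  split=> [xP | Px]; apply: trmx_inj; rewrite trmx_mul trmx0.
    by rewrite trmxK.
  by rewrite trmxK.
have basisE s (H' : 'M[{poly F}]_(a, s)) :
    poly_basis (fun x => x^T *m P = 0) H' <-> poly_basis (fun x => P^T *m x = 0) H'.
  by split=> -[rkH' PH']; split=> // x; rewrite -PH' trP.
by split=> -[/basisE bH minH]; split=> // s H' /basisE; exact: minH.
Qed.

Section SystemMatrix.
Variables (n m p : nat) (A : 'M[{poly F}]_n) (B : 'M[{poly F}]_(n, m)).
Variables (C : 'M[{poly F}]_(p, n)) (D : 'M[{poly F}]_(p, m)).
Hypothesis Areg : regular_pmx A.
Let M := - (invmx (pmx A) *m pmx B).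
Let G := pmx D + pmx C *m invmx (pmx A) *m pmx B.

(** Block elimination: the upper equation determines [x1] because [A] is invertible over the
    rational functions, and substituting it turns the lower one into [G *m x2 = 0]. *)
Lemma sysmx_kernel r (x1 : 'M[K]_(n, r)) (x2 : 'M_(m, r)) :
  pmx (sysmx A B C D) *m col_mx x1 x2 = 0 <-> x1 = M *m x2 /\ G *m x2 = 0.
Proof.
rewrite /pmx map_block_mx mul_block_col -!/(pmx _) pmxN.
have uA := pmx_unit Areg.
have CM : - pmx C *m (M *m x2) + pmx D *m x2 = G *m x2.
  by rewrite /M /G !mulNmx mulmxN opprK addrC mulmxDl !mulmxA.
split=> [/eqP | [-> Gx2]].
  rewrite col_mx_eq0 => /andP[/eqP Ax1 /eqP Cx1].
  have x1E : x1 = M *m x2.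
    rewrite -[x1](mulKmx uA) (eqP (_ : pmx A *m x1 == - (pmx B *m x2))).
      by rewrite mulmxN mulNmx mulmxA.
    by rewrite -addr_eq0 Ax1.
  by split; rewrite -?CM -?x1E.
rewrite CM Gx2; suff -> : pmx A *m (M *m x2) + pmx B *m x2 = 0 by exact: col_mx0.
by rewrite mulmxA mulmxN mulKVmx // mulNmx addNr.
Qed.

Lemma sysmx_poly_basis r (H1 : 'M[{poly F}]_(n, r)) (H2 : 'M_(m, r)) :
  poly_basis (fun x => pmx (sysmx A B C D) *m x = 0) (col_mx H1 H2) <->
  pmx H1 = M *m pmx H2 /\ poly_basis (fun x => G *m x = 0) H2.
Proof.
have pmx_colE : pmx (col_mx H1 H2) = col_mx (pmx H1) (pmx H2) by exact: map_col_mx.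
rewrite /poly_basis !rank_colP pmx_colE.
split=> [[injH PH] | [H1E [injH GH]]].
  have [H1E GH2] : pmx H1 = M *m pmx H2 /\ G *m pmx H2 = 0.
    apply/sysmx_kernel; rewrite -pmx_colE; apply: kernel_basis.
    by split; [apply/rank_colP; rewrite pmx_colE | rewrite pmx_colE].
  split=> //; split=> [y H2y | x].
    by apply: injH; rewrite mul_col_mx H1E -mulmxA H2y mulmx0 col_mx0.
  split=> [Gx | [y ->]]; last by rewrite mulmxA GH2 mul0mx.
  have /PH[y] : pmx (sysmx A B C D) *m col_mx (M *m x) x = 0 by apply/sysmx_kernel.
  by rewrite mul_col_mx => /eq_col_mx[_ ->]; exists y.
split=> [y /eqP | x].
  by rewrite mul_col_mx col_mx_eq0 => /andP[_ /eqP]; exact: injH.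
rewrite -[x]vsubmxK sysmx_kernel GH; split=> [[-> [y ->]] | [y]].
  by exists y; rewrite mul_col_mx H1E mulmxA.
by rewrite mul_col_mx => /eq_col_mx[-> ->]; rewrite H1E -mulmxA; split=> //; exists y.
Qed.

Hypothesis AC : right_coprime A C.
Hypothesis Mproper : proper_mx (invmx (pmx A) *m pmx B).

Let sysmx_coldeg r (H1 : 'M[{poly F}]_(n, r)) (H2 : 'M_(m, r)) j :
  pmx H1 = M *m pmx H2 -> coldeg (col_mx H1 H2) j = coldeg H2 j.
Proof. by apply: proper_coldeg; apply: proper_mxN; rewrite opprK. Qed.

(** Needed to lift polynomial bases of the kernel of [G] to polynomial, not merely rational, bases
    for the system matrix. *)
Lemma sysmx_top_poly r (H2 : 'M[{poly F}]_(m, r)) :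
  G *m pmx H2 = 0 -> exists H1, pmx H1 = M *m pmx H2.
Proof.
move=> GH2; have := (sysmx_kernel (M *m pmx H2) (pmx H2)).2 (conj erefl GH2).
rewrite /pmx map_block_mx mul_block_col -!/(pmx _) pmxN => /eqP.
rewrite col_mx_eq0 !addr_eq0 => /andP[/eqP AH1 /eqP CH1].
have [||H1 H1E] := right_coprime_poly (x := M *m pmx H2) (a := - (B *m H2))
  (c := D *m H2) Areg AC.
- by rewrite AH1 pmxN pmxM.
- by rewrite pmxM; apply: oppr_inj; rewrite -CH1; exact: esym (mulNmx _ _).
by exists H1.
Qed.

(** Competing bases correspond with equal degree sums: one for the system matrix restricts to its
    lower block, one for [G] lifts by [sysmx_top_poly]. *)
Lemma sysmx_minimal_basis r (H1 : 'M[{poly F}]_(n, r)) (H2 : 'M_(m, r)) :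
  right_minimal_basis (pmx (sysmx A B C D)) (col_mx H1 H2) <->
  pmx H1 = M *m pmx H2 /\ right_minimal_basis G H2.
Proof.
have degE s (K1 : 'M[{poly F}]_(n, s)) (K2 : 'M_(m, s)) :
    pmx K1 = M *m pmx K2 -> degsum (col_mx K1 K2) = degsum K2.
  by move=> K1E; apply: eq_bigr => j _; exact: sysmx_coldeg.
split=> [[/sysmx_poly_basis[H1E bH2] minH] | [H1E [bH2 minH2]]].
  split=> //; split=> // s K2 bK2.
  have [|K1 K1E] := @sysmx_top_poly s K2; first exact: kernel_basis bK2.
  by rewrite -(degE _ _ _ H1E) -(degE _ _ _ K1E); apply: minH; apply/sysmx_poly_basis.
split; first by apply/sysmx_poly_basis.
move=> s K; rewrite -[K]vsubmxK => /sysmx_poly_basis[K1E bK2].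
by rewrite (degE _ _ _ H1E) (degE _ _ _ K1E); exact: minH2.
Qed.

Lemma sysmx_right_minimal :
  (forall r (H2 : 'M[{poly F}]_(m, r)), right_minimal_basis G H2 ->
     exists H1 : 'M[{poly F}]_(n, r), pmx H1 = M *m pmx H2 /\
       right_minimal_basis (pmx (sysmx A B C D)) (col_mx H1 H2)) /\
  same_right_min_indices (pmx (sysmx A B C D)) G.
Proof.
split=> [r H2 minH2 | r H r' H'].
  have [|H1 H1E] := @sysmx_top_poly r H2; first exact: kernel_basis minH2.1.
  by exists H1; split=> //; apply/sysmx_minimal_basis.
rewrite -[H]vsubmxK => /sysmx_minimal_basis[H1E minH2] minH'.
(* The lower block of [H] is a minimal basis of [G] with the same degrees, so uniqueness of the
   indices of [G] suffices. *)
have <- : coldegs (dsubmx H) = coldegs (col_mx (usubmx H) (dsubmx H)).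
  by apply: eq_map => j; rewrite sysmx_coldeg.
exact: minimal_basis_coldegs minH2 minH'.
Qed.

End SystemMatrix.
End MinimalBases.

Theorem theorem3p8 (F : fieldType) (n m p : nat)
  (A : 'M[{poly F}]_n) (B : 'M[{poly F}]_(n, m))
  (C : 'M[{poly F}]_(p, n)) (D : 'M[{poly F}]_(p, m))
  (G : 'M[ratF F]_(p, m)) :
  regular_pmx A ->
  G = pmx D + pmx C *m invmx (pmx A) *m pmx B ->
  (* (a) *)
  (right_coprime A C ->
   proper_mx (invmx (pmx A) *m pmx B) ->
   forall r (H2 : 'M[{poly F}]_(m, r)),
     right_minimal_basis G H2 ->
     (exists H1 : 'M[{poly F}]_(n, r),
        pmx H1 = - (invmx (pmx A) *m pmx B *m pmx H2) /\
        right_minimal_basis (pmx (sysmx A B C D)) (col_mx H1 H2)) /\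
     same_right_min_indices (pmx (sysmx A B C D)) G)
  /\
  (* (b) *)
  (left_coprime A B ->
   proper_mx (pmx C *m invmx (pmx A)) ->
   forall r (H2 : 'M[{poly F}]_(p, r)),
     left_minimal_basis G H2 ->
     (exists H1 : 'M[{poly F}]_(n, r),
        pmx H1 = (pmx C *m invmx (pmx A))^T *m pmx H2 /\
        left_minimal_basis (pmx (sysmx A B C D)) (col_mx H1 H2)) /\
     same_left_min_indices (pmx (sysmx A B C D)) G).
Proof.
move=> Areg ->.
(* [sysmx] negates its third block, hence the sign on [B^T]. With these blocks the transfer function
   is the transpose of [G], and the two signs in [MT] cancel, so [H1] carries no minus sign in
   (b). *)
have tpose : sysmx A^T (- C^T) (- B^T) D^T = (sysmx A B C D)^T.
  by rewrite /sysmx tr_block_mx opprK linearN.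
have GT : pmx D^T + pmx (- B^T) *m invmx (pmx A^T) *m pmx (- C^T) =
    (pmx D + pmx C *m invmx (pmx A) *m pmx B)^T.
  rewrite !pmxN !mulNmx mulmxN opprK !pmx_tr -trmx_inv.
  by rewrite linearD /= !trmx_mul mulmxA.
have MT : - (invmx (pmx A^T) *m pmx (- C^T)) = (pmx C *m invmx (pmx A))^T.
  by rewrite pmxN mulmxN opprK !pmx_tr -trmx_inv trmx_mul.
have ATreg : regular_pmx A^T by rewrite /regular_pmx det_tr.
split=> [AC Mproper | AB Mproper] r H2 minH2.
  have [right_bases right_indices] := sysmx_right_minimal D Areg AC Mproper.
  split=> //; have [H1 [H1E minH1]] := right_bases _ _ minH2.
  by exists H1; split=> //; rewrite H1E mulNmx.
(* The sign of [B^T] is absorbed into the quotient and leaves the divisor [W] unchanged. *)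
have ABT : right_coprime A^T (- B^T).
  move=> W A1 C1 A1E /eqP; rewrite eqr_oppLR -mulNmx => /eqP.
  exact: AB A1E.
have MTproper : proper_mx (invmx (pmx A^T) *m pmx (- C^T)).
  apply: proper_mxN; rewrite MT => i j; rewrite mxE; exact: Mproper.
have [left_bases left_indices] := sysmx_right_minimal D^T ATreg ABT MTproper.
move: left_bases left_indices; rewrite tpose GT MT pmx_tr => left_bases left_indices.
split.
  have [H1 [H1E minH1]] := left_bases _ _ ((left_minimal_basis_tr _ _).1 minH2).
  by exists H1; split=> //; apply/left_minimal_basis_tr.
move=> s K s' K' minK minK'; apply: left_indices; exact/left_minimal_basis_tr.
Qed.
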